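(* Let $E$ be a topological space endowed with a $\gamma$-quasi-metric $\rho$. Let $\xi$ be an $E$-valued continuous adapted process and $N$ a nonnegative continuous adapted increasing process with $N_0=0$. Suppose that there exist $q,\kappa>0$ such that for all bounded stopping times $\tau'\leq\tau$, $$ \mathbb{E}\,\rho(\xi_{\tau},\xi_{\tau'})^q\leq\kappa\,\|N_\tau\|^q_\infty\,\mathbb{P}(\tau'<\tau). $$ Then for any $\Phi\in\mathscr{A}_0$, there is a positive constant $C=C(\gamma,q,\kappa,\Phi)$ (depending only on $\gamma,q,\kappa,\Phi$) such that for any bounded stopping time $\tau>0$, $$ \mathbb{E}\left(\sup_{t\in[0,\tau]}\Phi\big(\rho(\xi_t,\xi_0)\big)\right)\leq C\,\mathbb{E}\,\Phi(N_\tau). $$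
   Context: $(\Omega,\mathscr{F},(\mathscr{F}_t)_{t\geq 0},\mathbb{P})$ is a fixed stochastic basis satisfying the usual conditions; ''adapted'' and ''stopping time'' refer to $(\mathscr{F}_t)_{t\ge0}$. $\|\cdot\|_\infty$ denotes the (essential) supremum norm of a random variable. Quasi-metric: let $E$ be a topological space and $\gamma\geq 1$. A bi-continuous (i.e. jointly continuous) function $\rho:E\times E\to[0,\infty)$ is called a $\gamma$-quasi-metric on $E$ if (i) $\rho(x,y)=0$ if and only if $x=y$; (ii) $\rho(x,y)=\rho(y,x)$; (iii) $\rho(x,y)\leq\gamma(\rho(x,z)+\rho(y,z))$ for all $x,y,z\in E$. The class $\mathscr{A}_0$: a function $\Phi:(0,\infty)\to(0,\infty)$ is called moderately increasing if $\Phi$ is nondecreasing with $\lim_{s\to 0}\Phi(s)=0$ and for some $\lambda>1$ (and so, for all $\lambda>0$) there is $c_\lambda>0$ with $\Phi(\lambda t)\leq c_\lambda\Phi(t)$ for all $t$. $\mathscr{A}_0$ is the set of all moderately increasing functions. Such functions are extended by $\Phi(0):=0$. *)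

(* Defs.v *)
From HB Require Import structures.
From mathcomp Require Import all_boot all_order all_algebra.
From mathcomp Require Import all_classical all_reals all_analysis.

Set Implicit Arguments.
Unset Strict Implicit.
Unset Printing Implicit Defensive.

Import Order.TTheory GRing.Theory Num.Theory.
Import numFieldNormedType.Exports.

Local Open Scope classical_set_scope.
Local Open Scope ring_scope.

(* Random times and processes are indexed by R. Only times t >= 0 are
   meaningful, so every condition below is restricted to them. *)

Definition quasi_metric (R : realType) (E : topologicalType) (gamma : R)
    (rho : E -> E -> R) : Prop :=
  [/\ continuous (fun p : E * E => rho p.1 p.2),
      forall x y, 0 <= rho x y,
      forall x y, rho x y = 0 <-> x = y,
      forall x y, rho x y = rho y x &
      forall x y z, rho x y <= gamma * (rho x z + rho y z)].

(* The values of Phi outside ]0, +oo[ are irrelevant. *)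
Definition moderately_increasing (R : realType) (Phi : R -> R) : Prop :=
  [/\ forall s, 0 < s -> 0 < Phi s,
      forall s t, 0 < s -> s <= t -> Phi s <= Phi t,
      Phi s @[s --> 0^'+] --> 0 &
      exists2 lambda : R, 1 < lambda &
        exists2 c : R, 0 < c &
          forall t, 0 < t -> Phi (lambda * t) <= c * Phi t].

Definition ext0 (R : realType) (Phi : R -> R) (s : R) : R :=
  if 0 < s then Phi s else 0.

Definition borel_wrt (T : Type) (G : set (set T)) (E : topologicalType)
    (f : T -> E) : Prop :=
  forall B : set E, <<s open >> B -> G (f @^-1` B).

(* P.-negligible A means that A lies in a measurable set of probability 0, so
   basis_null and basis_measurable together also make P complete. *)
Record usual_basis (R : realType) (d : measure_display)
    (Omega : measurableType d) (P : probability Omega R)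
    (F : R -> set (set Omega)) : Prop := UsualBasis {
  basis_sigma : forall t, 0 <= t -> sigma_algebra setT (F t);
  basis_measurable : forall t, 0 <= t -> F t `<=` measurable;
  basis_null : forall A, P.-negligible A -> F 0 A;
  basis_mono : forall s t, 0 <= s -> s <= t -> F s `<=` F t;
  basis_right : forall t, 0 <= t ->
    \bigcap_(s in [set s | t < s]) F s `<=` F t }.

Definition adapted (R : realType) (Omega : Type) (F : R -> set (set Omega))
    (E : topologicalType) (X : R -> Omega -> E) : Prop :=
  forall t, 0 <= t -> borel_wrt (F t) (X t).

Definition continuous_process (R : realType) (Omega : Type)
    (E : topologicalType) (X : R -> Omega -> E) : Prop :=
  forall w, {within `[0, +oo[, continuous (fun t : R => X t w)}.

Definition increasing_process (R : realType) (Omega : Type)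
    (N : R -> Omega -> R) : Prop :=
  forall w s t, 0 <= s -> s <= t -> N s w <= N t w.

Definition bounded_stopping_time (R : realType) (Omega : Type)
    (F : R -> set (set Omega)) (tau : Omega -> R) : Prop :=
  [/\ forall w, 0 <= tau w,
      exists M : R, forall w, tau w <= M &
      forall t, 0 <= t -> F t [set w | tau w <= t]].

(* The process X evaluated at the random time tau. *)
Definition at_time (R Omega E : Type) (X : R -> Omega -> E)
  (tau : Omega -> R) : Omega -> E := fun w => X (tau w) w.

(* In a general E the Borel sets of E * E may be more than the product
   sigma-algebra, so adaptedness of X does not give that of rho (X t) (X 0);
   by the next lemma it does when E is second countable. *)
Lemma borel_wrt_continuous2 (T : Type) (G : set (set T))
    (E E' : topologicalType) (f : E * E -> E') (X Y : T -> E) :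
  sigma_algebra setT G -> @second_countable E -> continuous f ->
  borel_wrt G X -> borel_wrt G Y ->
  borel_wrt G (fun w => f (X w, Y w)).
Proof.
move=> [G0 GC GU] [B /countable_injP[g ginj] [Bo Bb]] cf mX mY.
have GD A A' : G A -> G A' -> G (A `&` A').
  move=> GA GA'; rewrite -[A `&` A']setCK setCI -setTD; apply: (GC).
  rewrite -bigcup2E; apply: (GU) => -[|[|n]] //=; rewrite -?setTD; exact: GC.
suff Go U : open U -> G ((fun w => f (X w, Y w)) @^-1` U).
  move=> A; apply: (@smallest_sub _ (sigma_algebra setT) open
      [set A | G ((fun w => f (X w, Y w)) @^-1` A)]) => //.
  split => [|A' GA'|A' GA'] /=.
  - by rewrite preimage_set0.
  - by rewrite setTD preimage_setC -setTD; exact: GC.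
  - by rewrite preimage_bigcup; exact: GU.
move=> oU; pose W : set (E * E) := f @^-1` U.
have oW : open W by apply: open_comp => // x _; exact: cf.
pose S n m : set T := [set w | exists a b, [/\ B a /\ B b, g a = n, g b = m,
   a `*` b `<=` W & a (X w) /\ b (Y w)]].
have GS n m : G (S n m).
  have [[a [b [Ba Bb' ga gb abW]]]|H] := pselect (exists a b,
      [/\ B a, B b, g a = n, g b = m & a `*` b `<=` W]); last first.
    rewrite (_ : S n m = set0)// -subset0 => w [a [b [[? ?] ? ? ? _]]].
    by apply: H; exists a, b.
  rewrite (_ : S n m = X @^-1` a `&` Y @^-1` b).
    by apply: GD; [apply: mX|apply: mY]; apply: sub_sigma_algebra; exact: Bo.
  apply/seteqP; split => [w [a' [b' [[Ba' Bb''] ga' gb' _ [aX bY]]]]|w [aX bY]].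
    split; first by rewrite (ginj a a') ?inE// ga ga'.
    by rewrite /= (ginj b b') ?inE// gb gb'.
  by exists a, b; split.
rewrite (_ : _ @^-1` U = \bigcup_n \bigcup_m S n m).
  by apply: (GU) => n; apply: (GU) => m.
apply/seteqP; split => [w fU|w [n _ [m _ [a [b [_ _ _ abW [aX bY]]]]]]].
  have : nbhs (X w, Y w) W by apply: open_nbhs_nbhs; split.
  case=> -[V1 V2] /= [nV1 nV2] VW.
  have [a [Ba aX] aV] := Bb (X w) _ nV1.
  have [b [Bb' bY] bV] := Bb (Y w) _ nV2.
  exists (g a) => //; exists (g b) => //; exists a, b; split => //.
  by move=> [x y] [/= /aV ? /bV ?]; exact: VW.
exact: (abW (X w, Y w)).
Qed.

(* Main.v *)
Require Import Defs.
From HB Require Import structures.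
From mathcomp Require Import all_boot all_order all_algebra.
From mathcomp Require Import all_classical all_reals all_analysis.
From mathcomp Require Import measurable_realfun ess_sup_inf ring lra.
Import Order.TTheory GRing.Theory Num.Theory.
Import numFieldNormedType.Exports.
Local Open Scope classical_set_scope.
Local Open Scope ring_scope.

(** Write X for the maximum of rho (xi_t, xi_0) over [0, tau] and Y for N_tau.
    The increment hypothesis involves N only through an essential supremum, so
    it is exploited on events where N is small, by a good-lambda inequality
      P (X >= 2 gamma x, Y < delta x) <= kappa delta^q P (X >= x)
    for all x, delta > 0 ([process_good_lambda]).

    To get it, stop first at the time sigma when N reaches delta x, so that N
    is bounded by delta x up to sigma, then let t1 <= t2 be the times before
    sigma at which rho (xi_t, xi_0) reaches x and 2 gamma x. On the event on
    the left, sigma = tau and both levels are reached, so the quasi-triangle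
    inequality gives rho (xi_t2, xi_t1) >= 2 gamma x / gamma - x = x. The event
    t1 < t2 forces level x to be reached, that is X >= x. The increment
    hypothesis for t1 <= t2 and Markov's inequality conclude.

    To pass from tails to E Phi, replace Phi by a step function on the
    geometric levels x0 b^i, with b = 2 gamma ([layer_sum]); its expectation is
    a finite combination of tails, to which the good-lambda inequality applies
    term by term. Moderate growth absorbs the factor b^2 lost in the
    discretisation, so with Z = min (X, x0 b^n)
      E Phi(Z) <= Phi(x0) + kappa delta^q c E Phi(Z) + c' E Phi(Y).
    The constant delta is chosen so that kappa delta^q c = 1/2. As E Phi(Z) is
    finite, the middle term is absorbed in the left-hand side; then x0 tends to
    0 at a fixed top level, and finally the top level tends to infinity
    ([good_lambda_moderate]). *)

Set Implicit Arguments.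
Unset Strict Implicit.
Unset Printing Implicit Defensive.

(** * Hitting times along a continuous path *)

(** The hitting time of [a, +oo[ capped at T >= 0. Adding T itself to the set
    makes it nonempty, and closed when g is continuous: the infimum is attained. *)
Definition first_time (R : realType) (g : R -> R) (a T : R) : R :=
  inf [set t | 0 <= t <= T /\ (a <= g t \/ t = T)].

Section FirstTime.
Context {R : realType}.
Implicit Types (g : R -> R) (a b s t T : R).

Let first_time_set_has_inf g a T : 0 <= T ->
  has_inf [set t | 0 <= t <= T /\ (a <= g t \/ t = T)].
Proof.
move=> T0; split; first by exists T; rewrite /= T0 lexx; split=> //; right.
by exists 0 => t [/andP[]].
Qed.

Lemma first_time_ge0 g a T : 0 <= T -> 0 <= first_time g a T.
Proof.
move=> /(first_time_set_has_inf g a)[ne _].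
by apply: lb_le_inf => // t [/andP[]].
Qed.

Lemma first_time_le g a T s :
  0 <= s <= T -> a <= g s \/ s = T -> first_time g a T <= s.
Proof.
move=> sT gs; have /andP[s0 sT'] := sT.
by apply: ge_inf; [case: (first_time_set_has_inf g a (le_trans s0 sT'))|split].
Qed.

Lemma first_time_le_horizon g a T : 0 <= T -> first_time g a T <= T.
Proof. by move=> T0; apply: first_time_le; [rewrite T0 lexx|right]. Qed.

Lemma lt_first_time g a T s : 0 <= T -> 0 <= s < first_time g a T -> g s < a.
Proof.
move=> T0 /andP[s0 sf]; rewrite ltNge; apply/negP => ags.
have sT : s <= T by rewrite (le_trans (ltW sf))// first_time_le_horizon.
by move: sf; rewrite ltNge first_time_le ?s0//; left.
Qed.

Lemma near_lt g a t : continuous g -> g t < a ->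
  exists2 e, 0 < e & forall s, `|t - s| < e -> g s < a.
Proof.
move=> cg ga; have [e e0 be] := iffLR (@nbhs_ballP R R t _) (cvgr_lt _ (cg t) _ ga).
by exists e => // s ts; exact: be.
Qed.

Lemma near_gt g a t : continuous g -> a < g t ->
  exists2 e, 0 < e & forall s, `|t - s| < e -> a < g s.
Proof.
move=> cg ga; have [e e0 be] := iffLR (@nbhs_ballP R R t _) (cvgr_gt _ (cg t) _ ga).
by exists e => // s ts; exact: be.
Qed.

Lemma first_time_hit g a T : continuous g -> 0 <= T ->
  a <= g (first_time g a T) \/ first_time g a T = T.
Proof.
move=> cg T0; set h := first_time g a T.
have [ah|ha] := leP a (g h); first by left.
have [hT|hT] := eqVneq h T; [by right|exfalso].
have {}hT : h < T by rewrite lt_neqAle hT first_time_le_horizon.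
have [e e0 he] := near_lt cg ha.
have [|t [/andP[t0 tT] gt] th] := @inf_adherent _ _ (Num.min e (T - h)) _
  (first_time_set_has_inf g a T0).
  by rewrite lt_min e0 subr_gt0.
have ht : h <= t by apply: first_time_le => //; rewrite t0.
move: th; rewrite -/(first_time g a T) -/h -ltrBlDl lt_min => /andP[te tT'].
case: gt => [|tTE].
  by rewrite leNgt he// ler0_norm ?subr_le0// opprB.
by move: tT'; rewrite tTE ltxx.
Qed.

Lemma first_time_le_level g a T : continuous g -> 0 <= T -> g 0 <= a ->
  g (first_time g a T) <= a.
Proof.
move=> cg T0 g0; have h0 := first_time_ge0 g a T0; move: h0.
set h := first_time g a T => h0.
rewrite leNgt; apply/negP => agh.
have {}h0 : 0 < h.
  by rewrite lt_neqAle h0 andbT; apply/eqP => hE; move: agh; rewrite -hE ltNge g0.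
have [e e0 he] := near_gt cg agh.
(* A time just before h, still nonnegative, at which g exceeds a. *)
pose s := h - Num.min e h / 2.
have m0 : 0 < Num.min e h by rewrite lt_min e0.
have [me mh] : Num.min e h <= e /\ Num.min e h <= h.
  by rewrite !ge_min !lexx orbT.
have : g s < a.
  apply: (@lt_first_time _ _ T) => //; rewrite -/h /s; apply/andP; split; lra.
apply/negP; rewrite -leNgt ltW// he// /s opprB addrC subrK gtr0_norm; lra.
Qed.

Lemma first_time_mono g a b T : continuous g -> 0 <= T -> a <= b ->
  first_time g a T <= first_time g b T.
Proof.
move=> cg T0 ab; apply: first_time_le.
  by rewrite first_time_ge0// first_time_le_horizon.
by have [bg|] := first_time_hit b cg T0; [left; exact: le_trans bg|right].
Qed.

(** Apart from the horizon T, the event that the hitting time is at most t only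
    involves the path up to t: hence first_time of a process is a stopping time. *)
Lemma first_time_leP g a T t : continuous g -> 0 <= T -> 0 <= t ->
  first_time g a T <= t <->
  T <= t \/ exists2 s, 0 <= s <= t & a <= g s.
Proof.
move=> cg T0 t0; split.
  move=> ht; have [ah|hT] := first_time_hit a cg T0; last first.
    by left; rewrite -hT.
  by right; exists (first_time g a T) => //; rewrite first_time_ge0.
case=> [Tt|[s /andP[s0 st] ags]].
  by rewrite (le_trans _ Tt)// first_time_le_horizon.
have [sT|Ts] := leP s T.
  by apply: le_trans st; apply: first_time_le; [rewrite s0|left].
apply: le_trans (le_trans (ltW Ts) st).
exact: first_time_le_horizon.
Qed.

(** The maximum over [0, T] is attained, so a strict bound leaves a margin
    1 / (n + 1), and a bound with a margin can be tested at rational times by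
    continuity. This turns an uncountable intersection of events into countable
    operations. *)
Lemma sublevel_ratP g a T : continuous g -> 0 <= T ->
  (forall s, 0 <= s <= T -> g s < a) <->
  exists n : nat, forall r : rat, 0 <= (ratr r : R) <= T ->
    g (ratr r) <= a - n.+1%:R^-1.
Proof.
move=> cg T0; split=> [ga|[n gr] s /andP[s0 sT]].
  have [m /itvP mT gm] := EVT_max T0 (continuous_subspaceT cg).
  have [|n mn] := @ltr_add_invr _ (g m) a; first by rewrite ga// !mT.
  exists n => r rT; rewrite lerBrDr (le_trans _ (ltW mn))// lerD2r gm//.
rewrite ltNge; apply/negP => ags.
have n0 : 0 < n.+1%:R^-1 :> R by rewrite invr_gt0.
have [|e e0 he] := @near_gt g (a - n.+1%:R^-1) s cg.
  by rewrite (lt_le_trans _ ags)// ltrBlDr ltrDl.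
have [r rT rs] : exists2 r : rat, 0 <= (ratr r : R) <= T & `|s - ratr r| < e.
  have [T0'|T0'] := eqVneq T 0.
    exists 0; rewrite rmorph0 ?T0' ?lexx//.
    by rewrite subr0 ger0_norm//; lra.
  have {}T0 : 0 < T by rewrite lt_neqAle eq_sym T0'.
  have [|r] := @rat_in_itvoo R (Num.max 0 (s - e)) (Num.min T (s + e)).
    by rewrite gt_max !lt_min; apply/andP; split; apply/andP; split; lra.
  rewrite in_itv/= gt_max lt_min => /andP[/andP[r0 r1] /andP[r2 r3]].
  by exists r; [rewrite !ltW|rewrite ltr_distlC; apply/andP; split; lra].
by have := he _ rs; rewrite ltNge gr.
Qed.

End FirstTime.

(** * Discretisation of a moderate function on geometric levels *)

Section Levels.
Context {R : realType} (Phi : R -> R).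
Hypothesis Phi_gt0 : forall s, 0 < s -> 0 < Phi s.
Hypothesis Phi_mono : forall s t, 0 < s -> s <= t -> Phi s <= Phi t.

Lemma ext0_ge0 s : 0 <= ext0 Phi s.
Proof. by rewrite /ext0; case: ifPn => // /Phi_gt0/ltW. Qed.

Lemma ext0_mono s t : s <= t -> ext0 Phi s <= ext0 Phi t.
Proof.
move=> st; rewrite {1}/ext0; case: ifPn => [s0|_]; last exact: ext0_ge0.
by rewrite /ext0 (lt_le_trans s0 st) Phi_mono.
Qed.

Lemma ext0E s : 0 < s -> ext0 Phi s = Phi s.
Proof. by rewrite /ext0 => ->. Qed.

Lemma ext0_scale k c s : 0 < k -> (forall t, 0 < t -> Phi (k * t) <= c * Phi t) ->
  ext0 Phi (k * s) <= c * ext0 Phi s.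
Proof.
move=> k0 kc; rewrite /ext0 pmulr_rgt0//.
by case: ifPn => [/kc//|]; rewrite mulr0.
Qed.

Context (b x0 : R) (b1 : 1 < b) (x00 : 0 < x0).

(** A finite layer-cake sum: up to the constant Phi x0, the step function with
    value Phi (x0 b^(i+1)) on [x0 b^i, x0 b^(i+1)[, constant beyond the level
    x0 b^n. Its expectation only involves tails. *)
Definition layer_sum (n : nat) (y : R) : R :=
  \sum_(i < n) ((Phi (x0 * b ^+ i.+1) - Phi (x0 * b ^+ i)) *
    (x0 * b ^+ i <= y)%R%:R).

Let x_gt0 n : 0 < x0 * b ^+ n.
Proof. by rewrite mulr_gt0// exprn_gt0// (lt_trans ltr01). Qed.

Let x_le n : x0 * b ^+ n <= x0 * b ^+ n.+1.
Proof. by rewrite ler_pM2l// ler_weXn2l// ltW. Qed.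

Lemma layer_incr_ge0 i : 0 <= Phi (x0 * b ^+ i.+1) - Phi (x0 * b ^+ i).
Proof. by rewrite subr_ge0 Phi_mono. Qed.

Lemma layer_sum_ge0 n y : 0 <= layer_sum n y.
Proof. by apply: sumr_ge0 => i _; rewrite mulr_ge0// layer_incr_ge0. Qed.

Let layer_sum_full n y : x0 * b ^+ n <= y ->
  layer_sum n.+1 y = Phi (x0 * b ^+ n.+1) - Phi x0.
Proof.
move=> xy; rewrite /layer_sum.
rewrite (eq_bigr (fun i : 'I_n.+1 =>
    Phi (x0 * b ^+ i.+1) - Phi (x0 * b ^+ i))); last first.
  move=> i _; rewrite (le_trans _ xy) ?mulr1// ler_pM2l// ler_weXn2l ?ltW//.
  by rewrite -ltnS.
rewrite -(big_mkord xpredT (fun i => Phi (x0 * b ^+ i.+1) - Phi (x0 * b ^+ i))).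
by rewrite telescope_sumr// expr0 mulr1.
Qed.

Let layer_sumSN n y : y < x0 * b ^+ n -> layer_sum n.+1 y = layer_sum n y.
Proof.
by move=> yx; rewrite /layer_sum big_ord_recr/= leNgt yx mulr0 addr0.
Qed.

(** The steps are taken at the right end of each interval, so the step function
    dominates Phi capped at the top level. *)
Lemma ext0_le_layer_sum n y :
  ext0 Phi (Num.min y (x0 * b ^+ n)) <= Phi x0 + layer_sum n y.
Proof.
elim: n => [|n IH].
  rewrite -(ext0E x00) -[leLHS]addr0 lerD// ?layer_sum_ge0//.
  by rewrite ext0_mono// expr0 mulr1 ge_min lexx orbT.
have [xy|yx] := leP (x0 * b ^+ n) y.
  rewrite layer_sum_full// addrC subrK -ext0E// ext0_mono//.
  by rewrite ge_min lexx orbT.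
rewrite layer_sumSN// (le_trans _ IH)// ext0_mono//.
by rewrite (min_l (ltW yx)) ge_min lexx.
Qed.

(** Conversely the right end of the interval that contains y is at most b y.
    Keeping the cap on the right is essential: the expectation of the capped
    function is finite and can be absorbed. *)
Lemma layer_sum_le_ext0 n y :
  layer_sum n y <= ext0 Phi (Num.min (b * y) (x0 * b ^+ n)).
Proof.
elim: n => [|n IH]; first by rewrite /layer_sum big_ord0 ext0_ge0.
have [xy|yx] := leP (x0 * b ^+ n) y.
  rewrite layer_sum_full// min_r; last first.
    by rewrite exprS mulrCA ler_pM2l// (lt_trans ltr01).
  by rewrite ext0E// gerBl ltW// Phi_gt0.
rewrite layer_sumSN// (le_trans IH)// ext0_mono// le_min ge_min lexx/=.
by rewrite ge_min x_le orbT.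
Qed.

End Levels.

Lemma expr_unbounded (R : realType) (b M : R) : 1 < b -> exists n, M < b ^+ n.
Proof.
move=> b1; have b0 : 0 < b by rewrite (lt_trans ltr01).
have : `|b^-1| < 1 by rewrite gtr0_norm ?invr_gt0// invf_lt1.
move=> /(cvg_geometric M)/cvgr_lt/(_ _ ltr01)/filter_ex[n /=].
by rewrite exprVn ltr_pdivrMr ?exprn_gt0// mul1r; exists n.
Qed.

Lemma moderate_scale (R : realType) (Phi : R -> R) (k : R) :
  moderately_increasing Phi -> 0 < k ->
  exists2 c : R, 0 < c & forall t, 0 < t -> Phi (k * t) <= c * Phi t.
Proof.
move=> [P0 Pm _ [l l1 [c c0 lc]]] k0.
have [n kn] := @expr_unbounded _ l k l1.
have l0 : 0 < l by rewrite (lt_trans ltr01).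
have H t : 0 < t -> Phi (l ^+ n * t) <= c ^+ n * Phi t.
  elim: n {kn} t => [|n IH] t t0; first by rewrite !expr0 !mul1r.
  by rewrite 2!exprS -!mulrA (le_trans (lc _ _)) ?mulr_gt0 ?exprn_gt0 ?ler_pM2l ?IH.
exists (c ^+ n); rewrite ?exprn_gt0// => t t0.
by rewrite (le_trans _ (H _ t0))// Pm ?mulr_gt0// ler_pM2r// ltW.
Qed.

(** * From a good-lambda inequality to moderate functions *)

Lemma nondecreasing_measurable (R : realType) (f : R -> R) :
  {homo f : x y / x <= y} -> measurable_fun setT f.
Proof.
move=> fm; apply: (measurability _ (RGenOInfty.measurableE R)).
move=> _ [_ [x ->] <-]; rewrite setTI; apply: is_interval_measurable => s t /=.
rewrite !in_itv/= !andbT => xs _ z /andP[sz _].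
by rewrite in_itv/= andbT (lt_le_trans xs)// fm.
Qed.

Section GoodLambda.
Context {R : realType} d (T : measurableType d) (P : probability T R).
Context (Phi : R -> R).
Hypothesis mPhi : moderately_increasing Phi.

Let P0 : forall s, 0 < s -> 0 < Phi s. Proof. by case: mPhi. Qed.
Let Pm : forall s t, 0 < s -> s <= t -> Phi s <= Phi t.
Proof. by case: mPhi. Qed.

Lemma measurable_ge (Z : T -> R) x : measurable_fun setT Z ->
  measurable [set w | x <= Z w].
Proof.
move=> mZ; rewrite (_ : [set _ | _] = Z @^-1` `[x, +oo[); last first.
  by apply/seteqP; split=> w /=; rewrite in_itv/= andbT.
by rewrite -[_ @^-1` _]setTI; apply: mZ.
Qed.

Lemma measurable_lt (Z : T -> R) x : measurable_fun setT Z ->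
  measurable [set w | Z w < x].
Proof.
move=> mZ; rewrite (_ : [set _ | _] = ~` [set w | x <= Z w]).
  by apply: measurableC; exact: measurable_ge.
by apply/seteqP; split=> w /=; rewrite ltNge => /negP.
Qed.

Lemma measurable_ext0 (Z : T -> R) : measurable_fun setT Z ->
  measurable_fun setT (fun w => ext0 Phi (Z w)).
Proof.
move=> mZ; apply: measurableT_comp => //.
by apply: nondecreasing_measurable => s t; exact: ext0_mono.
Qed.

Lemma integral_layer_sum b x0 n (Z : T -> R) : 1 < b -> 0 < x0 ->
  measurable_fun setT Z ->
  (\int[P]_w (layer_sum Phi b x0 n (Z w))%:E =
   \sum_(i < n) (Phi (x0 * b ^+ i.+1) - Phi (x0 * b ^+ i))%:E *
     P [set w | (x0 * b ^+ i <= Z w)%R])%E.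
Proof.
move=> b1 x00 mZ.
have mA i := measurable_ge (x0 * b ^+ i) mZ.
have indE i w : (x0 * b ^+ i <= Z w)%R%:R = \1_[set w | x0 * b ^+ i <= Z w] w :> R.
  by rewrite indicE; congr ((nat_of_bool _)%:R); apply/idP/idP; rewrite inE.
under eq_integral => w _.
  rewrite /layer_sum -sumEFin; under eq_bigr do rewrite indE EFinM; over.
rewrite ge0_integral_sum//; last 2 first.
- move=> i; apply: measurable_funeM; apply/measurable_EFinP.
  exact: measurable_indic.
- by move=> i w _; rewrite mule_ge0// lee_fin// layer_incr_ge0.
apply: eq_bigr => i _; rewrite ge0_integralZl_EFin ?layer_incr_ge0//.
- by rewrite integral_indic// setIT.
- by apply/measurable_EFinP; exact: measurable_indic.
Qed.

Context (X Y : T -> R) (b dlt eps c c' : R).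
Hypotheses (b1 : 1 < b) (dlt0 : 0 < dlt) (eps0 : 0 <= eps).
Hypotheses (epsc : eps * c <= 2^-1).
Hypothesis Phic : forall t, 0 < t -> Phi (b ^+ 2 * t) <= c * Phi t.
Hypothesis Phic' : forall t, 0 < t -> Phi (b ^+ 2 / dlt * t) <= c' * Phi t.
Hypotheses (mX : measurable_fun setT X) (mY : measurable_fun setT Y).
Hypothesis good : forall x, 0 < x ->
  (P [set w | (b * x <= X w)%R /\ (Y w < dlt * x)%R]
   <= eps%:E * P [set w | (x <= X w)%R])%E.

Let b0 : 0 < b. Proof. by rewrite (lt_trans ltr01). Qed.

(** For each level x = x0 b^i, the good-lambda inequality at x / b bounds
    P (X >= x) by eps P (X >= x / b) + P (Y >= dlt x / b), and both terms are
    tails of rescaled variables at the same level x. *)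
Let layer_good x0 n : 0 < x0 ->
  (\int[P]_w (layer_sum Phi b x0 n (X w))%:E <=
   eps%:E * \int[P]_w (layer_sum Phi b x0 n (b * X w))%:E +
   \int[P]_w (layer_sum Phi b x0 n (b / dlt * Y w))%:E)%E.
Proof.
move=> x00.
have mbX : measurable_fun setT (fun w => b * X w) by exact: measurable_funM.
have mbY : measurable_fun setT (fun w => b / dlt * Y w) by exact: measurable_funM.
rewrite !integral_layer_sum// ge0_sume_distrr; last first.
  by move=> i _; rewrite mule_ge0// lee_fin layer_incr_ge0.
rewrite -big_split/=; apply: lee_sum => i _.
rewrite muleCA -muleDr//; last first.
  by apply: ge0_adde_def; rewrite inE ?mule_ge0.
rewrite lee_wpmul2l// ?lee_fin ?layer_incr_ge0//.
set x := x0 * b ^+ i.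
have x_gt0 : 0 < x / b by rewrite divr_gt0// mulr_gt0// exprn_gt0.
have bx : b * (x / b) = x by rewrite mulrC divfK// gt_eqF.
have XE : [set w | x <= b * X w] = [set w | x / b <= X w].
  by apply/seteqP; split=> w /=; rewrite ler_pdivrMr// mulrC.
have YE : [set w | x <= b / dlt * Y w] = [set w | dlt * (x / b) <= Y w].
  have -> : dlt * (x / b) = (b / dlt)^-1 * x by rewrite invf_div [RHS]mulrAC mulrA.
  by apply/seteqP; split=> w /=; rewrite ler_pdivrMl// divr_gt0.
rewrite XE YE.
have mA : measurable [set w | b * (x / b) <= X w /\ Y w < dlt * (x / b)].
  apply: (@measurableI _ _ [set w | _ <= _] [set w | _ < _]).
    exact: measurable_ge.
  exact: measurable_lt.
apply: (@le_trans _ _ (P ([set w | b * (x / b) <= X w /\ Y w < dlt * (x / b)]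
   `|` [set w | dlt * (x / b) <= Y w]))).
  apply: le_measure; rewrite ?inE//.
  - exact: measurable_ge.
  - by apply: measurableU => //; exact: measurable_ge.
  - move=> w /= xX; have [?|?] := leP (dlt * (x / b)) (Y w); [by right|left].
    by rewrite bx.
apply: le_trans (measureU2 _ _ _) _ => //; first exact: measurable_ge.
by rewrite leeD2r// good.
Qed.

(** With I the expectation on the left, the discretisation gives
    I <= Phi x0 + I / 2 + c' J, and I <= Phi M < +oo allows the subtraction. *)
Let truncated_bound x0 n : 0 < x0 ->
  (\int[P]_w (ext0 Phi (Num.min (X w) (x0 * b ^+ n)))%:E <=
   (2 * Phi x0)%:E + (2 * c')%:E * \int[P]_w (ext0 Phi (Y w))%:E)%E.
Proof.
move=> x00; set M := x0 * b ^+ n.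
have M0 : 0 < M by rewrite mulr_gt0// exprn_gt0.
have c'0 : 0 < c'.
  by rewrite -(pmulr_lgt0 _ (P0 ltr01)) (lt_le_trans _ (Phic' ltr01))// P0//
    mulr1 divr_gt0// exprn_gt0.
have c_gt0 : 0 < c.
  by rewrite -(pmulr_lgt0 _ (P0 ltr01)) (lt_le_trans _ (Phic ltr01))// P0//
    mulr1 exprn_gt0.
have mXM : measurable_fun setT (fun w => Num.min (X w) M) by exact: measurable_minr.
have me (Z : T -> R) : measurable_fun setT Z ->
    measurable_fun setT (fun w => (ext0 Phi (Z w))%:E).
  by move=> mZ; apply/measurable_EFinP; exact: measurable_ext0.
set I := (\int[P]_w _)%E; set J := (\int[P]_w _)%E.
have e0 s : (0 <= (ext0 Phi s)%:E)%E by rewrite lee_fin ext0_ge0.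
have I0 : (0 <= I)%E by apply: integral_ge0.
have J0 : (0 <= J)%E by apply: integral_ge0.
have mL k (Z : T -> R) : measurable_fun setT Z ->
    measurable_fun setT (fun w => (layer_sum Phi b x0 k (Z w))%:E).
  move=> mZ; apply/measurable_EFinP; apply: measurableT_comp => //.
  apply: nondecreasing_measurable => s t st; apply: ler_sum => i _.
  rewrite ler_wpM2l ?layer_incr_ge0// ler_nat.
  by case: (leP _ s) => // /le_trans/(_ st) ->.
have L0 k s : (0 <= (layer_sum Phi b x0 k s)%:E)%E.
  by rewrite lee_fin layer_sum_ge0.
have mbX : measurable_fun setT (fun w => b * X w) by exact: measurable_funM.
have mbY : measurable_fun setT (fun w => b / dlt * Y w) by exact: measurable_funM.
have IPhi : (I <= (Phi M)%:E)%E.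
  apply: (@le_trans _ _ (\int[P]_w (Phi M)%:E)%E).
    apply: ge0_le_integral => //; first exact: me.
    move=> w _; rewrite lee_fin -(ext0E Phi M0) ext0_mono//.
    by rewrite ge_min lexx orbT.
  by rewrite integral_cst//= probability_setT mule1.
have H1 : (I <= (Phi x0)%:E + \int[P]_w (layer_sum Phi b x0 n (X w))%:E)%E.
  apply: (@le_trans _ _ (\int[P]_w ((Phi x0)%:E + (layer_sum Phi b x0 n (X w))%:E))%E).
    apply: ge0_le_integral => //; first exact: me.
      by apply: emeasurable_funD => //; exact: mL.
    by move=> w _; rewrite -EFinD lee_fin ext0_le_layer_sum.
  rewrite ge0_integralD//; first by rewrite integral_cst//= probability_setT mule1.
  - by move=> w _; rewrite lee_fin ltW// P0.
  - exact: mL.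
have H2 : (\int[P]_w (layer_sum Phi b x0 n (b * X w))%:E <= c%:E * I)%E.
  rewrite -ge0_integralZl_EFin ?(ltW c_gt0) ?(ltW c'0)//; last exact: me.
  apply: ge0_le_integral => //; first exact: mL.
    by apply: measurable_funeM; exact: me.
  move=> w _; rewrite -EFinM lee_fin (le_trans (layer_sum_le_ext0 P0 Pm b1 x00 _ _))//.
  apply: le_trans (ext0_scale _ _ Phic); last by rewrite exprn_gt0.
  apply: (ext0_mono P0 Pm); rewrite mulrA -expr2.
  have [XM|MX] := leP (X w) M; first by rewrite ge_min lexx.
  rewrite ge_min; apply/orP; right.
  by rewrite ler_peMl ?(ltW M0)// exprn_ege1// ltW.
have H3 : (\int[P]_w (layer_sum Phi b x0 n (b / dlt * Y w))%:E <= c'%:E * J)%E.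
  rewrite -ge0_integralZl_EFin ?(ltW c_gt0) ?(ltW c'0)//; last exact: me.
  apply: ge0_le_integral => //; first exact: mL.
    by apply: measurable_funeM; exact: me.
  move=> w _; rewrite -EFinM lee_fin (le_trans (layer_sum_le_ext0 P0 Pm b1 x00 _ _))//.
  apply: le_trans (ext0_scale _ _ Phic').
    apply: (ext0_mono P0 Pm); rewrite ge_min; apply/orP; left.
    by rewrite mulrA (mulrA b) -expr2.
  by rewrite divr_gt0// exprn_gt0.
have H4 := le_trans H1 (leeD2l (Phi x0)%:E (layer_good n x00)).
have H5 : (I <= (Phi x0)%:E + (2^-1%:E * I + c'%:E * J))%E.
  apply: (le_trans H4); rewrite leeD2l// leeD//.
  apply: (@le_trans _ _ (eps%:E * (c%:E * I))%E); first by rewrite lee_wpmul2l.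
  by rewrite muleA -EFinM lee_wpmul2r// lee_fin.
have If : I \is a fin_num by rewrite ge0_fin_numE// (le_lt_trans IPhi)// ltry.
have [Joo|Jf] := eqVneq J +oo%E.
  by rewrite Joo gt0_muley ?lte_fin ?mulr_gt0// addey// leey.
have {}Jf : J \is a fin_num by rewrite ge0_fin_numE// ltey.
move: H5; rewrite -(fineK If) -(fineK Jf) -!EFinM -!EFinD !lee_fin.
lra.
Qed.

Lemma good_lambda_moderate :
  (\int[P]_w (ext0 Phi (X w))%:E <=
   (2 * c')%:E * \int[P]_w (ext0 Phi (Y w))%:E)%E.
Proof.
have cap M : 0 < M -> (\int[P]_w (ext0 Phi (Num.min (X w) M))%:E <=
    (2 * c')%:E * \int[P]_w (ext0 Phi (Y w))%:E)%E.
  move=> M0; apply/lee_addgt0Pr => e e0.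
  have [s [Ps s0]] : exists s, Phi s < e / 2 /\ 0 < s.
    have [_ _ /cvgr_lt/(_ (e / 2))Phi0 _] := mPhi.
    apply: (@filter_ex _ (0 : R)^'+); apply: filterI; last exact: nbhs_right_gt.
    by apply: Phi0; rewrite divr_gt0.
  (* The n-th level above x0 = M / b^n is exactly the cap M. *)
  have [n Mn] := expr_unbounded (M / s) b1.
  have bn0 : 0 < b ^+ n by rewrite exprn_gt0.
  have x0 : 0 < M / b ^+ n by rewrite divr_gt0.
  have := truncated_bound n x0; rewrite divfK ?gt_eqF//.
  move=> /le_trans; apply; rewrite addeC leeD2l// lee_fin.
  rewrite -ler_pdivlMl// [_ * e]mulrC (le_trans _ (ltW Ps))// Pm//.
  by rewrite ler_pdivrMr// mulrC -ler_pdivrMr// ltW.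
have mXk k : measurable_fun setT (fun w => (ext0 Phi (Num.min (X w) k.+1%:R))%:E).
  by apply/measurable_EFinP; apply: measurable_ext0; exact: measurable_minr.
have := @cvg_monotone_convergence _ _ _ P setT measurableT _ mXk.
set lm := (X in _ -> _ -> _ --> X) => H.
have -> : (\int[P]_w (ext0 Phi (X w))%:E)%E = lm.
  apply: eq_integral => w _; apply/esym/cvg_lim => //.
  apply: cvg_near_cst; near=> k; congr (ext0 _ _)%:E; apply/min_idPl.
  apply: (@le_trans _ _ k%:R); last by rewrite ler_nat.
  by near: k; exact: nbhs_infty_ger.
have {}H : (\int[P]_w (ext0 Phi (Num.min (X w) k.+1%:R))%:E @[k --> \oo] --> lm)%E.
  apply: H => [k w _|w _ k l kl]; rewrite lee_fin; first exact: ext0_ge0.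
  apply: (ext0_mono P0 Pm).
  by rewrite le_min !ge_min lexx ler_nat ltnS kl orbT.
rewrite -(cvg_lim _ H)//.
by apply: lime_le; [exact/cvgP/H|apply: nearW => k; exact: cap].
Unshelve. all: by end_near. Qed.

End GoodLambda.

(** * Events, stopping times and running maxima *)

Section SigmaAlgebra.
Context {T : Type} (G : set (set T)) (sG : sigma_algebra setT G).

Lemma sigma_algebra_setC A : G A -> G (~` A).
Proof. by move=> GA; rewrite -setTD; case: sG => _ + _; apply. Qed.

Lemma sigma_algebra_bigcup_countable (I : countType) (A : I -> set T) :
  (forall r, G (A r)) -> G (\bigcup_r A r).
Proof.
move=> GA; have [G0 _ GU] := sG.
rewrite (_ : \bigcup_r A r = \bigcup_k oapp A set0 (unpickle k)).
  by apply: GU => k; case: unpickle => [r|] /=.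
apply/seteqP; split=> [w [r _ Arw]|w [k _]].
  by exists (pickle r) => //; rewrite pickleK.
by case: unpickle => [r|] //= Arw; exists r.
Qed.

Lemma sigma_algebra_setU A B : G A -> G B -> G (A `|` B).
Proof.
move=> GA GB; have [G0 _ GU] := sG.
by rewrite -bigcup2E; apply: GU => -[|[|k]].
Qed.

(** Stated for an arbitrary sigma-algebra so as to serve twice: with F t and the
    constant time t for stopping times, and with all measurable sets and a
    random time for running maxima. *)
Lemma sublevel_event {R : realType} (f : R -> T -> R) (tau : T -> R) a :
  (forall w, continuous (f^~ w)) -> (forall w, 0 <= tau w) ->
  (forall r b, 0 <= r -> G [set w | tau w < r \/ f r w <= b]) ->
  G [set w | forall s, 0 <= s <= tau w -> f s w < a].
Proof.
move=> cf tau0 Gf; have [G0 _ GU] := sG.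
rewrite (_ : [set _ | _] = \bigcup_n ~` \bigcup_(r : rat) ~`
    [set w | 0 <= (ratr r : R) -> tau w < ratr r \/
             f (ratr r) w <= a - n.+1%:R^-1]).
  apply: GU => n; apply: sigma_algebra_setC; apply: sigma_algebra_bigcup_countable => r.
  apply: sigma_algebra_setC; have [r0|r0] := boolP (0 <= (ratr r : R)).
    rewrite (_ : [set _ | _] = [set w | tau w < ratr r \/
      f (ratr r) w <= a - n.+1%:R^-1]); first exact: Gf.
    by apply/seteqP; split=> w /=; [exact|move=> + _].
  rewrite (_ : [set _ | _] = setT); last by apply/seteqP; split.
  by rewrite -setC0; exact: sigma_algebra_setC.
apply/seteqP; split=> w /=.
  move=> /(sublevel_ratP a (cf w) (tau0 w))[n fn]; exists n => //.
  rewrite setC_bigcup => r _; rewrite setCK /= => r0.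
  by have [?|?] := ltP (tau w) (ratr r); [left|right; apply: fn; rewrite r0].
move=> [n _]; rewrite setC_bigcup => fn.
apply/(sublevel_ratP a (cf w) (tau0 w)); exists n => r /andP[r0 rt].
by have := fn r Logic.I; rewrite setCK /= => /(_ r0)[]; rewrite // ltNge rt.
Qed.

End SigmaAlgebra.

Section RunningMax.
Context {R : realType}.

Definition running_max (g : R -> R) (T : R) : R :=
  sup [set g s | s in [set s | 0 <= s <= T]].

Lemma running_maxP g T : continuous g -> 0 <= T ->
  exists2 s, 0 <= s <= T & running_max g T = g s /\
    forall t, 0 <= t <= T -> g t <= g s.
Proof.
move=> cg T0; have [m mT gm] := EVT_max T0 (continuous_subspaceT cg).
exists m; first by move: mT; rewrite in_itv.
have gm' t : 0 <= t <= T -> g t <= g m by move=> tT; rewrite gm// in_itv.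
split=> //; apply/eqP; rewrite eq_le; apply/andP; split.
  apply: ge_sup; last by move=> _ [t tT <-]; exact: gm'.
  by exists (g 0); exists 0; rewrite //= lexx.
apply: ub_le_sup; last by exists m => //; move: mT; rewrite in_itv.
by exists (g m) => _ [t tT <-]; exact: gm'.
Qed.

Lemma running_max_ltP g T a : continuous g -> 0 <= T ->
  running_max g T < a <-> forall s, 0 <= s <= T -> g s < a.
Proof.
move=> cg T0; have [m mT [-> gm]] := running_maxP cg T0.
split=> [gma s sT|]; last exact.
exact: le_lt_trans (gm s sT) gma.
Qed.

Lemma running_max_geP g T a : continuous g -> 0 <= T ->
  a <= running_max g T <-> exists2 s, 0 <= s <= T & a <= g s.
Proof.
move=> cg T0; have [m mT [-> gm]] := running_maxP cg T0.
split=> [|[s sT /le_trans]]; [by exists m|by apply; exact: gm].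
Qed.

End RunningMax.

Definition level_adapted (R : realType) (Omega : Type)
    (F : R -> set (set Omega)) (f : R -> Omega -> R) : Prop :=
  forall t a, 0 <= t -> F t [set w | f t w <= a].

Section Filtration.
Context {R : realType} {d} {Omega : measurableType d} (P : probability Omega R).
Context (F : R -> set (set Omega)) (uF : usual_basis P F).
Implicit Types (f : R -> Omega -> R) (tau : Omega -> R).

Lemma stopping_time_measurable tau : bounded_stopping_time F tau ->
  measurable_fun setT tau.
Proof.
move=> [tau0 _ Ftau]; apply: (measurability _ (RGenOInfty.measurableE R)).
move=> _ [_ [x ->] <-]; rewrite setTI.
have [x0|x0] := leP 0 x.
  rewrite (_ : _ @^-1` _ = ~` [set w | tau w <= x]).
    by apply: measurableC; apply: (basis_measurable uF x0); exact: Ftau.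
  by apply/seteqP; split=> w /=; rewrite in_itv/= andbT ltNge => /negP.
rewrite (_ : _ @^-1` _ = setT)//; apply/seteqP; split=> w //= _.
by rewrite in_itv/= andbT (lt_le_trans x0).
Qed.

Lemma running_max_measurable f tau :
  (forall w, continuous (f^~ w)) -> level_adapted F f ->
  bounded_stopping_time F tau ->
  measurable_fun setT (fun w => running_max (f^~ w) (tau w)).
Proof.
move=> cf af stau; have mtau := stopping_time_measurable stau.
case: stau => tau0 _ _.
apply: (measurability _ (RGenInftyO.measurableE R)).
move=> _ [_ [x ->] <-]; rewrite setTI.
rewrite (_ : _ @^-1` _ = [set w | forall s, 0 <= s <= tau w -> f s w < x]).
  apply: sublevel_event => // [|r b r0]; first exact: sigma_algebra_measurable.
  apply: (@measurableU _ _ [set w | _ < _] [set w | _ <= _]).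
    exact: measurable_lt.
  by apply: (basis_measurable uF r0); exact: af.
by apply/seteqP; split=> w /=; rewrite in_itv/= => /running_max_ltP; apply.
Qed.

Lemma first_time_stopping f tau a :
  (forall w, continuous (f^~ w)) -> level_adapted F f ->
  bounded_stopping_time F tau ->
  bounded_stopping_time F (fun w => first_time (f^~ w) a (tau w)).
Proof.
move=> cf af [tau0 [M tauM] Ftau]; split.
- by move=> w; exact: first_time_ge0.
- by exists M => w; rewrite (le_trans _ (tauM w))// first_time_le_horizon.
move=> t t0; have sF := basis_sigma uF t0.
rewrite (_ : [set _ | _] = [set w | tau w <= t] `|`
    ~` [set w | forall s, 0 <= s <= t -> f s w < a]).
  apply: sigma_algebra_setU => //; first exact: Ftau.
  apply: sigma_algebra_setC => //; apply: (@sublevel_event _ _ sF _ f (fun=> t)) => //.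
  move=> r b r0 /=; have [tr|rt] := ltP t r.
    rewrite (_ : [set _ | _] = ~` set0).
      by apply: sigma_algebra_setC => //; case: sF.
    by apply/seteqP; split=> w /= _; [case|left].
  rewrite (_ : [set _ | _] = [set w | f r w <= b]).
    by apply: (basis_mono uF r0 rt); exact: af.
  by apply/seteqP; split=> w /=; [case|right].
apply/seteqP; split=> w /=.
  move/(first_time_leP a (cf w) (tau0 w) t0) => [?|[s st fs]]; first by left.
  by right => /(_ _ st); rewrite ltNge fs.
move=> H; apply/(first_time_leP a (cf w) (tau0 w) t0).
case: H => [?|H]; [by left|right].
apply: contrapT => nex; apply: H => s st; rewrite ltNge; apply/negP => fs.
by apply: nex; exists s.
Qed.

(** Markov's inequality for a function g that may fail to be measurable, as
    rho (xi_t2, xi_t1) may be when E is not second countable: the integral is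
    then a supremum over simple functions below g, and k 1_A is one of them. *)
Lemma level_le_integral (A : set Omega) (k : R) (g : Omega -> R) :
  measurable A -> 0 <= k -> (forall w, 0 <= g w) -> (forall w, A w -> k <= g w) ->
  (k%:E * P A <= \int[P]_w (g w)%:E)%E.
Proof.
move=> mA k0 g0 kg; rewrite ge0_integralTE; last by move=> w; rewrite lee_fin.
pose h := scale_nnsfun (indic_nnsfun R mA) k0.
apply: ereal_sup_ubound; exists h.
  move=> w /=; rewrite lee_fin mindicE.
  by have [/set_mem/kg|_] := boolP (w \in A); rewrite ?mulr1// mulr0.
by rewrite sintegralrM sintegral_indic.
Qed.

End Filtration.

(** * The good-lambda inequality for the process *)

(** Reflecting the time at 0 replaces continuity within [0, +oo[ by continuity
    on the whole line, so that paths can be handled without a domain. *)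
Lemma continuous_reflect (R : realType) (E : topologicalType) (g : R -> E) :
  {within `[0, +oo[, continuous g} -> continuous (fun t : R => g `|t|).
Proof.
move=> /subspace_continuousP cg x.
apply: (cvg_comp _ _ _ (cg `|x| _)); last by rewrite /= in_itv/= andbT.
move=> B wB; have H : nbhs x [set t : R | [set` `[0, +oo[] `|t| -> B `|t|] :=
  @norm_continuous _ R x _ wB.
by apply: (filterS _ H) => t /=; apply; rewrite in_itv/= normr_ge0.
Qed.

Lemma adapted_level (R : realType) (Omega : Type) (F : R -> set (set Omega))
    (f : R -> Omega -> R) : adapted F f -> level_adapted F (fun t : R => f `|t|).
Proof.
move=> af t a t0; rewrite ger0_norm//.
rewrite (_ : [set _ | _] = f t @^-1` `]-oo, a]); last first.
  by apply/seteqP; split=> w /=; rewrite in_itv.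
apply: af => //; rewrite -setCitvr -setTD; apply: sigma_algebraCD.
by apply: sub_sigma_algebra; exact: interval_open.
Qed.

Section GoodLambdaProcess.
Context {R : realType} {d} {Omega : measurableType d} (P : probability Omega R).
Context (F : R -> set (set Omega)) (uF : usual_basis P F).
Context (E : topologicalType) (gamma : R) (rho : E -> E -> R).
Context (xi : R -> Omega -> E) (N : R -> Omega -> R).
Hypotheses (gamma1 : 1 <= gamma) (qrho : quasi_metric gamma rho).
Hypotheses (cxi : continuous_process xi).
Hypothesis axi : adapted F (fun t w => rho (xi t w) (xi 0 w)).
Hypotheses (cN : continuous_process N) (aN : adapted F N).
Hypotheses (iN : increasing_process N) (N0 : forall w, N 0 w = 0).

Let f (t : R) w := rho (xi `|t| w) (xi 0 w).
Let M (t : R) w := N `|t| w.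

Lemma continuous_distance w : continuous (f^~ w).
Proof.
move=> t; have [crho _ _ _ _] := qrho.
apply: (@continuous_comp _ _ _ (fun t : R => (xi `|t| w, xi 0 w))
  (fun p : E * E => rho p.1 p.2) t _ (crho _)).
apply: cvg_pair; last exact: cvg_cst.
exact: (@continuous_reflect _ _ (xi^~ w) (@cxi w) t).
Qed.

Let cM w : continuous (M^~ w). Proof. exact: (@continuous_reflect _ _ (N^~ w) (@cN w)). Qed.

Let lf : level_adapted F f. Proof. exact: (adapted_level axi). Qed.
Let lM : level_adapted F M. Proof. exact: (adapted_level aN). Qed.

Lemma running_max_increasing w T : 0 <= T -> running_max (M^~ w) T = N T w.
Proof.
move=> T0; have [s /andP[s0 sT] [-> gs]] := running_maxP (@cM w) T0.
apply/eqP; rewrite eq_le /M (ger0_norm s0) iN//=.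
by have := gs T; rewrite T0 lexx /M !ger0_norm//; apply.
Qed.

Context (q kappa : R) (q0 : 0 < q) (kappa0 : 0 < kappa).
Hypothesis increment : forall tau' tau : Omega -> R,
  bounded_stopping_time F tau' -> bounded_stopping_time F tau ->
  (forall w, tau' w <= tau w) ->
  ('E_P[fun w => (rho (at_time xi tau w) (at_time xi tau' w) `^ q)%R]
   <= kappa%:E * ('N[P]_+oo[EFin \o at_time N tau] `^ q)
      * P [set w | (tau' w < tau w)%R])%E.
Context (tau : Omega -> R) (stau : bounded_stopping_time F tau).

Let X w := running_max (f^~ w) (tau w).
Let Y w := N (tau w) w.

Let tau0 w : 0 <= tau w. Proof. by case: stau. Qed.

Let mX : measurable_fun setT X.
Proof. exact: (running_max_measurable uF continuous_distance). Qed.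

Let mY : measurable_fun setT Y.
Proof.
have := running_max_measurable uF cM lM stau.
by under eq_fun do rewrite running_max_increasing//.
Qed.

(** The event t1 < t2 lies in X >= x, and N_t2 <= dlt x everywhere because
    t2 <= sigma; on the event of the left-hand side rho (xi_t2, xi_t1) >= x. *)
Lemma process_good_lambda dlt x : 0 < dlt -> 0 < x ->
  (P [set w | ((2 * gamma) * x <= X w)%R /\ (Y w < dlt * x)%R]
   <= (kappa * dlt `^ q)%:E * P [set w | (x <= X w)%R])%E.
Proof.
move=> dlt0 x0; have [_ rho0 rhoE rhoC rhoT] := qrho.
have dx0 : 0 < dlt * x by rewrite mulr_gt0.
pose sigma w := first_time (M^~ w) (dlt * x) (tau w).
have ssigma : bounded_stopping_time F sigma.
  exact: (first_time_stopping uF _ cM).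
have sigma0 w : 0 <= sigma w by case: ssigma.
pose t1 w := first_time (f^~ w) x (sigma w).
pose t2 w := first_time (f^~ w) (2 * gamma * x) (sigma w).
have st1 : bounded_stopping_time F t1.
  exact: (first_time_stopping uF _ continuous_distance).
have st2 : bounded_stopping_time F t2.
  exact: (first_time_stopping uF _ continuous_distance).
have t1_0 w : 0 <= t1 w by case: st1.
have t2_0 w : 0 <= t2 w by case: st2.
have x2x : x <= 2 * gamma * x by rewrite ler_peMl ?ltW//; move: gamma1; lra.
have t12 w : t1 w <= t2 w.
  by apply: first_time_mono => //; exact: continuous_distance.
set A := [set w | _ /\ _].
have mA : measurable A.
  apply: (@measurableI _ _ [set w | _ <= _] [set w | _ < _]).
    exact: measurable_ge.
  exact: measurable_lt.
have f0 w : f 0 w = 0 by rewrite /f normr0; exact/rhoE.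
(* On A the process N stays below dlt x up to tau, so sigma = tau; both levels
   are reached, and the increment between t1 and t2 is at least x. *)
have lower w : A w -> x `^ q <= rho (at_time xi t2 w) (at_time xi t1 w) `^ q.
  move=> [xX Yx]; rewrite ge0_ler_powR ?nnegrE ?(ltW x0) ?rho0 ?(ltW q0)//.
  have sigmaE : sigma w = tau w.
    have [|//] := first_time_hit (dlt * x) (@cM w) (tau0 w).
    rewrite -/(sigma w) /M ger0_norm// => h; exfalso; move: Yx; apply/negP.
    rewrite -leNgt (le_trans h)// iN//.
    exact: first_time_le_horizon.
  have f2 : 2 * gamma * x <= f (t2 w) w.
    have [//|t2E] := first_time_hit (2 * gamma * x) (@continuous_distance w) (sigma0 w).
    have /(running_max_geP _ (@continuous_distance w) (tau0 w)) [s /andP[s0 sT] fs] := xX.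
    have [st|ts] := ltP s (t2 w).
      have := @lt_first_time _ (f^~ w) (2 * gamma * x) (sigma w) s (sigma0 w).
      by rewrite s0 st ltNge fs => /(_ isT).
    suff -> : t2 w = s by [].
    by apply/eqP; rewrite eq_le ts /t2 t2E sigmaE sT.
  have f1 : f (t1 w) w <= x.
    by apply: (@first_time_le_level _ (f^~ w)) => //;
      [exact: continuous_distance|rewrite f0 ltW].
  have : f (t2 w) w <= gamma * (rho (at_time xi t2 w) (at_time xi t1 w) + x).
    apply: le_trans (rhoT _ _ (xi (t1 w) w)) _.
    rewrite /f !ger0_norm// ler_wpM2l ?(le_trans ler01)// lerD2l.
    by move: f1; rewrite /f ger0_norm// rhoC.
  move=> /(le_trans f2); rewrite (mulrC 2) -mulrA ler_pM2l ?(lt_le_trans ltr01)//.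
  by lra.
have Nnorm : ('N[P]_+oo[EFin \o at_time N t2] <= (dlt * x)%:E)%E.
  rewrite Lnorm.unlock; case: ifP => _; last by rewrite lee_fin ltW.
  apply/ess_supP; apply: nearW => w /=.
  rewrite lee_fin /at_time.
  have t2s : t2 w <= sigma w by exact: first_time_le_horizon.
  rewrite ger0_norm; last by rewrite -(N0 w) iN.
  apply: (@le_trans _ _ (M (sigma w) w)); first by rewrite /M ger0_norm// iN.
  by apply: (@first_time_le_level _ (M^~ w)) => //; rewrite /M normr0 N0 ltW.
(* If level x is not reached then t1 = t2 = sigma. *)
have sub : [set w | t1 w < t2 w] `<=` [set w | x <= X w].
  move=> w /= lt12.
  have t2s : t2 w <= sigma w by exact: first_time_le_horizon.
  have [ft1|t1E] := first_time_hit x (@continuous_distance w) (sigma0 w).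
    apply/(running_max_geP _ (@continuous_distance w) (tau0 w)).
    exists (t1 w) => //; rewrite t1_0 (le_trans (ltW lt12))// (le_trans t2s)//.
    exact: first_time_le_horizon.
  by move: lt12; rewrite /t1 t1E ltNge t2s.
have mt12 : measurable [set w | t1 w < t2 w].
  have := measurable_fun_ltr (stopping_time_measurable uF st1)
    (stopping_time_measurable uF st2).
  by move=> /(_ measurableT [set true]); rewrite setTI; exact.
have xq0 : 0 < x `^ q by rewrite powR_gt0.
rewrite -(@lee_pmul2l _ (x `^ q)%:E)//.
apply: le_trans (level_le_integral P mA (ltW xq0) _ lower) _.
  by move=> w; exact: powR_ge0.
have := increment st1 st2 t12; rewrite expectation.unlock => /le_trans; apply.
apply: (@le_trans _ _ (kappa%:E * ((dlt * x)%:E `^ q) * P [set w | (x <= X w)%R])%E).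
  apply: lee_pmul => //.
  - by apply: mule_ge0; [rewrite lee_fin ltW|exact: poweR_ge0].
  - rewrite lee_wpmul2l ?lee_fin ?(ltW kappa0)//.
    by apply: gt0_ler_poweR; rewrite ?in_itv/= ?leey ?andbT ?lee_fin
      ?(ltW q0) ?(ltW dx0) ?Lnorm_ge0.
  - by apply: le_measure; rewrite ?inE//; exact: measurable_ge.
rewrite poweR_EFin powRM ?(ltW dlt0) ?(ltW x0)// muleA -!EFinM.
by rewrite mulrA [_ * x `^ q]mulrC.
Qed.

End GoodLambdaProcess.

(** * The moment inequality *)

(** The supremum is attained where g is maximal, since Phi is monotone. An
    equality is needed, not a mere bound: it turns the integrand into a
    measurable function. *)
Lemma ereal_sup_ext0 (R : realType) (Phi g h : R -> R) (T : R) :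
  moderately_increasing Phi -> continuous g -> 0 <= T ->
  (forall t, 0 <= t -> h t = g t) ->
  ereal_sup [set (ext0 Phi (h t))%:E | t in [set` `[0, T]]] =
  (ext0 Phi (running_max g T))%:E.
Proof.
move=> [P0 Pm _ _] cg T0 hg.
have [s sT [-> gs]] := running_maxP cg T0; have /andP[s0 _] := sT.
apply/eqP; rewrite eq_le; apply/andP; split.
  apply: ge_ereal_sup => _ [t /= + <-]; rewrite in_itv/= => tT.
  have /andP[t0 _] := tT.
  by rewrite lee_fin hg//; apply: (ext0_mono P0 Pm); exact: gs.
by apply: ereal_sup_ubound; exists s; rewrite /= ?in_itv//= hg.
Qed.

Unset Implicit Arguments.

Theorem theorem1p3 (R : realType) (gamma q kappa : R) (Phi : R -> R)
    (hgamma : 1 <= gamma) (hq : 0 < q) (hkappa : 0 < kappa)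
    (hPhi : moderately_increasing Phi) :
  exists2 C : R, 0 < C &
  forall (d : measure_display) (Omega : measurableType d)
    (P : probability Omega R) (F : R -> set (set Omega))
    (E : topologicalType) (rho : E -> E -> R)
    (xi : R -> Omega -> E) (N : R -> Omega -> R),
  usual_basis P F ->
  quasi_metric gamma rho ->
  continuous_process xi -> adapted F xi ->
  adapted F (fun t w => rho (xi t w) (xi 0 w)) ->
  (forall t w, 0 <= t -> 0 <= N t w) ->
  continuous_process N -> adapted F N -> increasing_process N ->
  (forall w, N 0 w = 0) ->
  (forall tau' tau : Omega -> R,
     bounded_stopping_time F tau' -> bounded_stopping_time F tau ->
     (forall w, tau' w <= tau w) ->
     ('E_P[fun w => (rho (at_time xi tau w) (at_time xi tau' w) `^ q)%R]
      <= kappa%:E * ('N[P]_+oo[EFin \o at_time N tau] `^ q)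
         * P [set w | (tau' w < tau w)%R])%E) ->
  forall tau : Omega -> R,
    bounded_stopping_time F tau -> (forall w, 0 < tau w) ->
    (\int[P]_w ereal_sup [set (ext0 Phi (rho (xi t w) (xi 0 w)))%:E
                          | t in [set` `[0%R, tau w]]]
     <= C%:E * 'E_P[fun w => ext0 Phi (at_time N tau w)])%E.
Proof.
have b1 : 1 < 2 * gamma by move: hgamma; lra.
have b20 : 0 < (2 * gamma) ^+ 2 by rewrite exprn_gt0// (lt_trans ltr01).
have [c c0 Phic] := moderate_scale hPhi b20.
(* This choice makes kappa dlt^q c equal to 1/2. *)
pose dlt := (2 * kappa * c)^-1 `^ q^-1.
have kc0 : 0 < 2 * kappa * c by rewrite !mulr_gt0.
have dlt0 : 0 < dlt by rewrite powR_gt0// invr_gt0.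
have [c' c'0 Phic'] := moderate_scale hPhi (divr_gt0 b20 dlt0).
have epsc : kappa * dlt `^ q * c <= 2^-1.
  rewrite -powRrM mulVf ?gt_eqF// powRr1; last by rewrite invr_ge0 ltW.
  rewrite le_eqVlt; apply/orP; left; apply/eqP; field.
  by rewrite !gt_eqF.
exists (2 * c'); first by rewrite mulr_gt0.
move=> d Omega P F E rho xi N uF qrho cxi _ axi _ cN aN iN N0 increment tau stau _.
have tau0 w : 0 <= tau w by case: stau.
pose f (t : R) w := rho (xi `|t| w) (xi 0 w).
pose M (t : R) w := N `|t| w.
have cf w : continuous (f^~ w) by exact: (continuous_distance qrho cxi).
have cM w : continuous (M^~ w) by exact: (@continuous_reflect _ _ (N^~ w) (cN w)).
have NM : at_time N tau = (fun w => running_max (M^~ w) (tau w)).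
  by apply/funext => w; rewrite (running_max_increasing cN iN).
rewrite expectation.unlock.
under eq_integral => w _.
  rewrite (ereal_sup_ext0 hPhi (cf w) (tau0 w)); last first.
    by move=> t t0; rewrite /f ger0_norm.
  over.
apply: (@good_lambda_moderate _ _ _ P _ hPhi _ _ (2 * gamma) dlt (kappa * dlt `^ q) c) => //.
- by rewrite mulr_ge0 ?powR_ge0// ltW.
- exact: (running_max_measurable uF cf (adapted_level axi)).
- by rewrite NM; exact: (running_max_measurable uF cM (adapted_level aN)).
- move=> x x0.
  exact: (process_good_lambda uF hgamma qrho cxi axi cN aN iN N0 hq hkappa increment).
Qed.
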